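(* Let $S$ be the set containing 12 copies of each even positive integer that is not a multiple of 3, and let $T$ be the set containing 12 copies of each odd positive integer that is not a multiple of 3. Let $D_S(N)$ (respectively, $D_T(N)$) be the number of partitions of $N$ into an odd number of distinct elements of $S$ (respectively, $T$). Then, for every integer $N\geq 4$, $$D_S(N)=D_T(N-3).$$
   Context: A ''set containing several copies'' of certain integers means a set of colored integers: the different copies of the same integer are regarded as distinct (distinguishable) elements, each having that integer as its value. A partition of $N$ into distinct elements of $X$ is a finite subset of $X$ whose elements have values summing to $N$ (so each copy is used at most once, but different copies of the same integer may be used together, and subsets using different copies are counted as different); the number of parts is the cardinality of this subset. *)

(* Defs.v *)
From mathcomp Require Import all_boot finmap.
From mathcomp Require Import classical_sets cardinality.

Set Implicit Arguments.
Unset Strict Implicit.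
Unset Printing Implicit Defensive.

Local Open Scope classical_set_scope.
Local Open Scope fset_scope.
Local Open Scope nat_scope.

(* The pair [(n, c)] is the copy of the integer [n] with color [c]. *)
Notation colored := (nat * 'I_12)%type.

Definition value (x : colored) : nat := x.1.

Definition S_set : set colored :=
  [set x | [/\ 0 < value x, ~~ odd (value x) & ~~ (3 %| value x)]].

Definition T_set : set colored :=
  [set x | [/\ 0 < value x, odd (value x) & ~~ (3 %| value x)]].

Definition odd_partitions (X : set colored) (N : nat) : set {fset colored} :=
  [set P : {fset colored} |
    [/\ forall x, x \in P -> X x, \sum_(x <- P) value x = N & odd #|` P|]].

Lemma finite_odd_partitions (X : set colored) (N : nat) :
  finite_set (odd_partitions X N).
Proof.
pose B : {fset colored} :=
  seq_fset tt [seq (n, c) | n <- iota 0 N.+1, c <- enum 'I_12].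
apply: (sub_finite_set _ (finite_fset (fpowerset B))) => P [_ sumP _] /=.
rewrite fpowersetE; apply/fsubsetP => -[n c] xP.
rewrite seq_fsetE; apply/allpairsP; exists (n, c).
split; rewrite ?mem_enum // mem_iota /= add0n ltnS -sumP.
by rewrite (big_fsetD1 (n, c)) //= leq_addr.
Qed.

(* [fset_set] is the empty set on infinite sets; [finite_odd_partitions]
   shows that this default value never occurs here. *)
Definition D (X : set colored) (N : nat) : nat :=
  #|` fset_set (odd_partitions X N)|.

Definition D_S (N : nat) : nat := D S_set N.

Definition D_T (N : nat) : nat := D T_set N.

(* Main.v *)
Require Import Defs.
From mathcomp Require Import all_boot.
From mathcomp Require Import all_order all_algebra finmap.
From mathcomp Require Import classical_sets cardinality.
From mathcomp Require Import zify ring.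

(** Let [A c], [B c] be the products of [1 + c q^n] over the odd, respectively
even, [n > 0] prime to 3. The number of partitions of [N] into an odd number of
distinct elements of [S] is half of the coefficient of [q^N] in
[B(1)^12 - B(-1)^12], and likewise for [T] with [A] ([odd_subsets_coef],
[D_card]). So the theorem says that
[B(1)^12 - B(-1)^12 = q^3 (A(1)^12 - A(-1)^12) + 24 q^2]
([degree3_products]): the term [24 q^2] is the only exception, and it lies
below [q^4].

Up to powers of [q], the four twelfth powers are modular functions for
Gamma0(12), a group of genus 0, so they are rational functions of one of them.
Here the parameter is an explicit product [t = q + ...], such that [1 + t],
[1 + 2t], [1 - 2t] and [1 + 4t] are again products of the same kind; given
this, the identity is a polynomial identity in [t] ([degree3_algebra]).

That these four are products amounts to four three-term relations between
theta functions of modulus 6. By Jacobi's triple product ([triple_product],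
[theta_tprod]) the theta functions are the required products. Splitting
a double sum by parity ([theta_mul]) writes the product of two of them as
a bilinear expression in four series [b 0, ..., b 3], and in terms of these
series each of the four relations follows by expanding.

All of this is carried out not with power series but in a commutative ring with
a nilpotent element [x] in the role of [q]: infinite sums and products are then
finite, and factors [1 + c x^n] are invertible. Polynomials modulo [q^(N+1)]
form such a ring, and it retains the coefficients up to [q^N]
([in_qpoly_coef]). *)

Set Implicit Arguments.
Unset Strict Implicit.
Unset Printing Implicit Defensive.

Import GRing.Theory Num.Theory.

(** * Gaussian binomials *)

Section GaussianBinomial.
Local Open Scope ring_scope.
Context {R : comNzRingType} (Q : R).

Fixpoint gbin (n k : nat) : R :=
  match n, k with
  | _, 0%N => 1
  | 0%N, _.+1 => 0
  | n'.+1, k'.+1 => gbin n' k' + Q ^+ k'.+1 * gbin n' k'.+1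
  end.

Lemma gbinn0 n : gbin n 0 = 1. Proof. by case: n. Qed.

Lemma gbinSS n k :
  gbin n.+1 k.+1 = gbin n k + Q ^+ k.+1 * gbin n k.+1.
Proof. by []. Qed.

Lemma gbin_small n k : (n < k)%N -> gbin n k = 0.
Proof.
elim: n k => [|n IHn] [|k] //; rewrite ltnS => lt_nk.
by rewrite gbinSS !IHn ?mulr0 ?addr0 // ltnW.
Qed.

(** The second Pascal rule. The triple product needs both rules, one for each of
its two families of factors. *)
Lemma gbinSS' n k : (k <= n)%N ->
  gbin n.+1 k.+1 = Q ^+ (n - k) * gbin n k + gbin n k.+1.
Proof.
elim: n k => [|n IHn] k le_kn.
  by move: le_kn; rewrite leqn0 => /eqP->; rewrite /= expr0; ring.
have [-> | ne_kn] := eqVneq k n.+1.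
  rewrite gbinSS subnn [gbin n.+1 n.+2]gbin_small //.
  by rewrite mulr0 mul1r.
have le_kn' : (k <= n)%N by lia.
rewrite [LHS]gbinSS.
case: k {le_kn ne_kn} le_kn' => [|k] le_kn.
  rewrite [in LHS](IHn 0%N) // [gbin n.+1 1]gbinSS !gbinn0 !subn0 !mulr1.
  by rewrite [Q ^+ n.+1]exprS expr1; ring.
rewrite [gbin n.+1 k.+1 in LHS]IHn ?(ltnW le_kn) // [gbin n.+1 k.+2 in LHS]IHn //.
rewrite gbinSS [gbin n.+1 k.+2]gbinSS.
have -> : (n.+1 - k.+1 = (n - k.+1).+1)%N by lia.
have -> : (n - k = (n - k.+1).+1)%N by lia.
rewrite !exprS; ring.
Qed.

(** The product formula for Gaussian binomials, in a form without division:
comparing the two Pascal rules gives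
[gbin n k.+1 * (1 - Q ^+ k.+1) = gbin n k * (1 - Q ^+ (n - k))]. *)
Lemma gbin_prod n k : (k <= n)%N ->
  gbin n k * \prod_(i < k) (1 - Q ^+ i.+1) = \prod_(i < k) (1 - Q ^+ (n - i)).
Proof.
elim: k => [|k IHk] le_kn; first by rewrite !big_ord0 gbinn0 mulr1.
rewrite !big_ord_recr /= -IHk ?(ltnW le_kn) //.
(* the difference of the two Pascal rules *)
have e : gbin n k.+1 * (1 - Q ^+ k.+1) = gbin n k * (1 - Q ^+ (n - k)).
  have /eqP := gbinSS' (ltnW le_kn); rewrite gbinSS -subr_eq0 => /eqP e.
  by apply/eqP; rewrite -subr_eq0 -oppr_eq0 -[X in _ == X]e; apply/eqP; ring.
by rewrite [LHS]mulrCA e; ring.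
Qed.

End GaussianBinomial.
Arguments gbin : simpl never.

(** * The triple product *)

(** With [Q = a * b] and [A j = a ^ (j * (j + 1) / 2) * b ^ (j * (j - 1) / 2)],
multiplying [A j] by [a * Q ^+ m] or by [b * Q ^+ n] moves the index by one up
to a power of [Q]; only this is used, so that [A] may be any sequence which
satisfies the two rules and no negative power of [Q] is ever written. *)
Section FiniteTripleProduct.
Local Open Scope ring_scope.
Context {R : comNzRingType} (a b Q : R) (A : int -> R).
Hypothesis A0 : A 0 = 1.
Hypothesis Aup : forall (m : nat) (j : int), j <= m%:Z ->
  a * Q ^+ m * A j = Q ^+ absz (m%:Z - j)%R * A (j + 1).
Hypothesis Adown : forall (n : nat) (j : int), - n%:Z <= j ->
  b * Q ^+ n * A j = Q ^+ absz (n%:Z + j)%R * A (j - 1).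

(** Induction on [m], then on [n]. A new factor [1 + a * Q ^+ m] acts on the
coefficients by the second Pascal rule, a new factor [1 + b * Q ^+ n] by the
first. *)
Lemma finite_triple_product m n :
  \prod_(i < m) (1 + a * Q ^+ i) * \prod_(i < n) (1 + b * Q ^+ i) =
  \sum_(k < (m + n).+1) gbin Q (m + n) k * A (k%:Z - n%:Z).
Proof.
elim: n => [|n IHn].
  rewrite big_ord0 mulr1 addn0.
  elim: m => [|m IHm]; first by rewrite big_ord0 big_ord1 /= gbinn0 subrr A0 mulr1.
  rewrite big_ord_recr /= IHm mulrDr mulr1.
  have -> : (\sum_(k < m.+1) gbin Q m k * A (k%:Z - 0%:Z)) * (a * Q ^+ m) =
            \sum_(k < m.+1) Q ^+ (m - k) * gbin Q m k * A (k.+1%:Z - 0%:Z).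
    rewrite mulr_suml; apply: eq_bigr => k _.
    rewrite -mulrA [A _ * _]mulrC Aup; last by have := ltn_ord k; lia.
    have -> : absz (m%:Z - (k%:Z - 0%:Z))%R = (m - k)%N by have := ltn_ord k; lia.
    have -> : k%:Z - 0%:Z + 1 = k.+1%:Z - 0%:Z by lia.
    by ring.
  rewrite [RHS]big_ord_recl /= gbinn0.
  under [X in _ = _ + X]eq_bigr => k _.
    rewrite /bump leq0n add1n gbinSS' -1?ltnS // mulrDl. over.
  rewrite big_split /= [RHS]addrCA [LHS]addrC; congr (_ + _).
  rewrite [LHS]big_ord_recl [in RHS]big_ord_recr /= [gbin Q m m.+1]gbin_small //.
  by rewrite gbinn0 mul0r [X in _ = _ + X]addr0.
rewrite big_ord_recr /= mulrA IHn addnS mulrDr mulr1.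
set N := (m + n)%N.
have -> : (\sum_(k < N.+1) gbin Q N k * A (k%:Z - n%:Z)) * (b * Q ^+ n) =
          \sum_(k < N.+1) Q ^+ k * gbin Q N k * A (k%:Z - n.+1%:Z).
  rewrite mulr_suml; apply: eq_bigr => k _.
  rewrite -mulrA [A _ * _]mulrC Adown; last by lia.
  have -> : absz (n%:Z + (k%:Z - n%:Z))%R = k by lia.
  have -> : k%:Z - n%:Z - 1 = k%:Z - n.+1%:Z by lia.
  by ring.
rewrite [RHS]big_ord_recl /= gbinn0.
under [X in _ = _ + X]eq_bigr => k _.
  rewrite /bump leq0n add1n gbinSS mulrDl.
  have -> : k.+1%:Z - n.+1%:Z = k%:Z - n%:Z by lia.
  over.
rewrite big_split /= [RHS]addrCA; congr (_ + _).
rewrite [LHS]big_ord_recl [in RHS]big_ord_recr /= [gbin Q N N.+1]gbin_small //.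
rewrite gbinn0 mulr0 mul0r [X in _ = _ + X]addr0 expr0 !mul1r; congr (_ + _).
apply: eq_bigr => k _; rewrite /bump leq0n add1n.
by have -> : k.+1%:Z - n.+1%:Z = k%:Z - n%:Z by lia.
Qed.

End FiniteTripleProduct.

Section BilateralSums.
Local Open Scope ring_scope.

(** Bilateral sums are taken over a finite range outside which all terms
vanish; this is what makes the choice of the range irrelevant. *)
Lemma big_subseq_supp (R : nmodType) (I : eqType) (s t : seq I) (F : I -> R) :
    uniq s -> uniq t -> {subset s <= t} ->
    (forall i, i \in t -> i \notin s -> F i = 0) ->
  \sum_(i <- t) F i = \sum_(i <- s) F i.
Proof.
move=> us ut st F0.
rewrite (bigID (fun i => i \in s)) /= [X in _ + X]big_seq_cond.
rewrite [X in _ + X]big1 ?addr0 => [|i /andP[]]; last exact: F0.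
rewrite -big_filter; apply: perm_big; apply: uniq_perm => //.
  exact: filter_uniq.
by move=> i; rewrite mem_filter; case: (boolP (i \in s)) => // /st ->.
Qed.

Definition ints (K : nat) : seq int := [seq k%:Z - K%:Z | k <- iota 0 K.*2.+1].

Lemma ints_uniq K : uniq (ints K).
Proof. by rewrite map_inj_uniq ?iota_uniq // => i j; lia. Qed.

Lemma mem_ints K j : (j \in ints K) = (`|j|%N <= K)%N.
Proof.
apply/mapP/idP => [[k] | le_jK]; first by rewrite mem_iota => /andP[_ ?] ->; lia.
by exists (absz (j + K%:Z)%R); rewrite ?mem_iota; lia.
Qed.

End BilateralSums.

Section Theta.
Local Open Scope ring_scope.
Context {R : comUnitRingType} (x : R) (M : nat).
Hypothesis xM : x ^+ M = 0.

Lemma expr_nilp e : (M <= e)%N -> x ^+ e = 0.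
Proof. by move=> /subnK <-; rewrite exprD xM mulr0. Qed.

Lemma expr_sign (c : R) p q : c * c = 1 -> odd p = odd q -> c ^+ p = c ^+ q.
Proof.
move=> cc e; rewrite -[p]odd_double_half -[q]odd_double_half e -!mul2n.
by rewrite !(exprD _ (odd q)) !(exprM _ 2) expr2 cc !expr1n.
Qed.

(** [theta c L r] is Ramanujan's theta function [f (c x^(L + r), c x^(L - r))],
that is, the sum of [c^j x^(L j^2 + r j)] over all integers [j], for a sign
[c]. As [x ^+ M = 0], only [`|j| <= M] matters when [r <= L]. *)
Definition theta_term (c : R) (L r : nat) (j : int) : R :=
  c ^+ `|j|%N * x ^+ `|(L%:Z * j * j + r%:Z * j)%R|%N.

Definition theta (c : R) (L r : nat) : R := \sum_(j <- ints M) theta_term c L r j.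

Lemma theta_exp_ge0 (L r : nat) (j : int) :
  (r <= L)%N -> 0 <= L%:Z * j * j + r%:Z * j.
Proof. by move=> ?; case: j => n; nia. Qed.

Lemma theta_term0 c L r j : (0 < L)%N -> (r <= L)%N -> (M < `|j|%N)%N ->
  theta_term c L r j = 0.
Proof.
move=> L0 rL jM; rewrite /theta_term expr_nilp ?mulr0 //.
have := theta_exp_ge0 j rL; case: j jM => n /= jM ?; nia.
Qed.

Lemma theta_widen c L r K : (0 < L)%N -> (r <= L)%N -> (M <= K)%N ->
  \sum_(j <- ints K) theta_term c L r j = theta c L r.
Proof.
move=> L0 rL MK; apply: big_subseq_supp; rewrite ?ints_uniq //.
  by move=> j; rewrite !mem_ints; lia.
by move=> j _; rewrite mem_ints -ltnNge => ?; rewrite theta_term0.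
Qed.

Lemma prod_nilp (F : nat -> R) K : (forall i, (M <= i)%N -> F i = 1) ->
  (M <= K)%N -> \prod_(i < K) F i = \prod_(i < M) F i.
Proof.
move=> F1 MK; rewrite -!(big_mkord xpredT F) (big_cat_nat (n := M)) //=.
rewrite [X in _ * X]big_nat_cond [X in _ * X]big1 ?mulr1 // => i iM.
by rewrite F1 //; lia.
Qed.

(** Far from the two ends of its row, a Gaussian binomial agrees with its
limit, the inverse of the Euler product. *)
Lemma gbin_nilp (L n k : nat) : (0 < L)%N -> (M <= k)%N -> (M + k <= n)%N ->
  gbin (x ^+ L) n k * \prod_(i < M) (1 - (x ^+ L) ^+ i.+1) = 1.
Proof.
move=> L0 Mk kn.
rewrite -(@prod_nilp (fun i => 1 - (x ^+ L) ^+ i.+1) k) //; last first.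
  by move=> i Mi; rewrite -exprM expr_nilp ?subr0 //; nia.
rewrite gbin_prod; last by lia.
apply: big1 => i _; rewrite -exprM expr_nilp ?subr0 //.
by have := ltn_ord i; nia.
Qed.

(** Jacobi's triple product: in the finite one, each coefficient times the
Euler product is 1 unless [j] is so large that the power of [x] vanishes. *)
Lemma triple_product (c : R) (L r K : nat) :
    c * c = 1 -> (0 < L)%N -> (r <= L)%N -> (M.*2 <= K)%N ->
  theta c L r = \prod_(i < M) (1 - x ^+ (L.*2 * i + L.*2)) *
    (\prod_(i < K) (1 + c * x ^+ (L.*2 * i + (L + r))) *
     \prod_(i < K) (1 + c * x ^+ (L.*2 * i + (L - r)))).
Proof.
move=> cc L0 rL MK.
have -> : \prod_(i < M) (1 - x ^+ (L.*2 * i + L.*2)) =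
          \prod_(i < M) (1 - (x ^+ L.*2) ^+ i.+1).
  by apply: eq_bigr => i _; rewrite -exprM mulnS addnC.
have eP e : \prod_(i < K) (1 + c * x ^+ (L.*2 * i + e)) =
            \prod_(i < K) (1 + c * x ^+ e * (x ^+ L.*2) ^+ i).
  by apply: eq_bigr => i _; rewrite -exprM -mulrA -exprD addnC.
rewrite !{}eP (finite_triple_product (A := theta_term c L r)); first last.
- move=> n j jn; rewrite /theta_term.
  have -> : c * x ^+ (L - r) * x ^+ L.*2 ^+ n *
     (c ^+ `|j|%N * x ^+ `|(L%:Z * j * j + r%:Z * j)%R|%N) =
     c ^+ `|j|.+1 * x ^+ (L - r + L.*2 * n + `|(L%:Z * j * j + r%:Z * j)%R|%N).
    by rewrite -exprM !exprD exprS; ring.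
  rewrite (@expr_sign c `|j|.+1 (`|(j - 1)%R|%N)) //; last by lia.
  rewrite mulrCA -exprM -exprD; congr (_ * x ^+ _).
  have := theta_exp_ge0 j rL; have := theta_exp_ge0 (j - 1) rL; nia.
- move=> n j jn; rewrite /theta_term.
  have -> : c * x ^+ (L + r) * x ^+ L.*2 ^+ n *
     (c ^+ `|j|%N * x ^+ `|(L%:Z * j * j + r%:Z * j)%R|%N) =
     c ^+ `|j|.+1 * x ^+ (L + r + L.*2 * n + `|(L%:Z * j * j + r%:Z * j)%R|%N).
    by rewrite -exprM !exprD exprS; ring.
  rewrite (@expr_sign c `|j|.+1 (`|(j + 1)%R|%N)) //; last by lia.
  rewrite mulrCA -exprM -exprD; congr (_ * x ^+ _).
  have := theta_exp_ge0 j rL; have := theta_exp_ge0 (j + 1) rL; nia.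
- by rewrite /theta_term !mulr0 addr0 !expr0 mulr1.
rewrite -(theta_widen c (K := K)) //; last by lia.
rewrite /ints big_map -[K.*2.+1]subn0 -/(index_iota _ _) big_mkord mulr_sumr -addnn.
apply: eq_bigr => k _; have [jM | jM] := leqP `|(k%:Z - K%:Z)%R| M.
  by rewrite mulrA [_ * gbin _ _ _]mulrC gbin_nilp ?mul1r ?double_gt0 //; lia.
by rewrite theta_term0 // !mulr0.
Qed.

End Theta.

(** * Products of two theta functions *)

Section ThetaMul.
Local Open Scope ring_scope.
Context {R : comUnitRingType} (x : R) (M : nat).
Hypothesis xM : x ^+ M = 0.
Notation theta := (theta x M).
Notation theta_term := (theta_term x).

Lemma theta_mulE (c d : R) L K r s : theta c L r * theta d K s =
  \sum_(p <- [seq (m, n) | m <- ints M, n <- ints M])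
    theta_term c L r p.1 * theta_term d K s p.2.
Proof.
rewrite /theta mulr_suml big_allpairs; apply: eq_bigr => m _.
by rewrite mulr_sumr.
Qed.

(** The product is a sum over pairs [(m, n)]. When [m + n] is even, the pair is
[(u + v, u - v)] for unique [u] and [v]; when it is odd, it is
[(- u - v - 1, v - u)]. In both cases the quadratic form [m ^ 2 + n ^ 2]
loses its mixed term and the sum factors; the signs in the odd case make the
factors theta functions of the same shape, with [L - X] and [L - Y] in place of
[X] and [Y]. With
[b i = theta 1 L.*2 i.*2], all products obtained are bilinear in the [b i],
so identities between them are polynomial identities. *)
Lemma theta_mul (c : R) (L X Y : nat) :
    c * c = 1 -> (0 < L)%N -> (Y <= X)%N -> (X + Y <= L)%N ->
  theta c L (X + Y) * theta c L (X - Y) =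
    theta 1 L.*2 X.*2 * theta 1 L.*2 Y.*2 +
    c * x ^+ (L - X - Y) *
      (theta 1 L.*2 (L - X).*2 * theta 1 L.*2 (L - Y).*2).
Proof.
move=> cc L0 YX XYL; rewrite !theta_mulE.
pose box := [seq (m, n) | m <- ints M, n <- ints M].
pose F p := theta_term c L (X + Y) p.1 * theta_term c L (X - Y) p.2.
pose ev (p : int * int) := (p.1 + p.2, p.1 - p.2).
pose od (p : int * int) := (- p.1 - p.2 - 1, p.2 - p.1).
have uniq_box : uniq box.
  by apply: allpairs_uniq; rewrite ?ints_uniq // => -[? ?] [? ?].
have mem_box m n : ((m, n) \in box) = (`|m|%N <= M)%N && (`|n|%N <= M)%N.
  rewrite -!mem_ints; apply/allpairsP/andP => [[[u v] [/= ? ? [-> ->]]] //|[? ?]].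
  by exists (m, n).
have Fev p : F (ev p) =
    theta_term 1 L.*2 X.*2 p.1 * theta_term 1 L.*2 Y.*2 p.2.
  case: p => u v; rewrite /F /theta_term /= !expr1n !mul1r mulrACA -!exprD.
  rewrite (@expr_sign _ c _ 0 cc) ?mul1r; last by lia.
  congr (x ^+ _); apply/eqP; rewrite -eqz_nat !PoszD !gez0_abs ?theta_exp_ge0 //; try lia.
  by apply/eqP; rewrite -!addnn !PoszD -subzn //; ring.
have Fod p : F (od p) = c * x ^+ (L - X - Y) *
    (theta_term 1 L.*2 (L - X).*2 p.1 * theta_term 1 L.*2 (L - Y).*2 p.2).
  case: p => u v; rewrite /F /theta_term /= !expr1n !mul1r mulrACA -!exprD.
  rewrite (@expr_sign _ c _ 1 cc) ?expr1; last by lia.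
  rewrite -[RHS]mulrA -exprD; congr (_ * x ^+ _).
  apply/eqP; rewrite -eqz_nat !PoszD !gez0_abs ?theta_exp_ge0 //; try lia.
  apply/eqP; rewrite -!addnn !PoszD -!subzn //; try lia; ring.
rewrite mulr_sumr -(eq_bigr _ (fun p _ => Fev p)) -(eq_bigr _ (fun p _ => Fod p)).
rewrite -(big_map ev xpredT F) -(big_map od xpredT F) -big_cat.
symmetry; apply: big_subseq_supp.
- exact: uniq_box.
- rewrite cat_uniq !map_inj_uniq; first last.
  + by move=> [u v] [u' v'] [] *; congr pair; lia.
  + by move=> [u v] [u' v'] [] *; congr pair; lia.
  rewrite !uniq_box !andTb.
  rewrite andbT; apply/hasPn => p /mapP [[u v] _ ->].
  by apply/mapP => -[[u' v'] _ []]; lia.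
- move=> [m n]; rewrite mem_box mem_cat => /andP[mM nM].
  apply/orP.
  have [e | e] := boolP (odd `|(m + n)%R|).
    right; apply/mapP; exists (- ((m + n + 1) %/ 2)%Z, ((n - m - 1) %/ 2)%Z).
      by rewrite mem_box; lia.
    by congr pair; rewrite /=; lia.
  left; apply/mapP; exists (((m + n) %/ 2)%Z, ((m - n) %/ 2)%Z).
    by rewrite mem_box; lia.
  by congr pair; rewrite /=; lia.
move=> [m n] _; rewrite mem_box negb_and -!ltnNge /F /= => /orP[] ?.
  by rewrite (theta_term0 xM) ?mul0r.
by rewrite [X in _ * X](theta_term0 xM) ?mulr0 //; lia.
Qed.

End ThetaMul.

(** * Infinite products *)

Section TruncatedProducts.
Local Open Scope ring_scope.
Context {R : comUnitRingType} (x : R) (M : nat).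
Hypothesis xM : x ^+ M = 0.

(** The infinite product over [n > 0] with [P n]; its factors with [n >= M] are
equal to 1. *)
Definition tprod (P : pred nat) (c : R) : R :=
  \prod_(1 <= n < M | P n) (1 + c * x ^+ n).

Lemma exponent_gt0 : (0 < M)%N.
Proof. by case: M xM => // /eqP; rewrite expr0 oner_eq0. Qed.

Lemma eq_tprod (P Q : pred nat) c : P =1 Q -> tprod P c = tprod Q c.
Proof. by move=> PQ; apply: eq_bigl. Qed.

Lemma tprodID (P a : pred nat) c :
  tprod P c = tprod (fun n => P n && a n) c * tprod (fun n => P n && ~~ a n) c.
Proof. exact: bigID. Qed.

Lemma tprod_widen (P : pred nat) c K : (M <= K)%N ->
  \prod_(1 <= n < K | P n) (1 + c * x ^+ n) = tprod P c.
Proof.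
move=> MK; rewrite /tprod (big_cat_nat exponent_gt0 MK) /= big_nat_cond.
rewrite [X in _ * X]big_nat_cond [X in _ * X]big1 ?mulr1 -?big_nat_cond //.
by move=> n /andP[/andP[Mn _] _]; rewrite (expr_nilp xM Mn) mulr0 addr0.
Qed.

(** A factor is 1 plus a nilpotent element, hence inverted by a finite geometric
sum. *)
Lemma tprod_unit P c : tprod P c \is a GRing.unit.
Proof.
rewrite /tprod big_nat_cond; apply: rpred_prod => n /andP[/andP[n0 _] _].
apply/unitrP; exists (\sum_(i < M) (- (c * x ^+ n)) ^+ i).
suff e : (1 + c * x ^+ n) * \sum_(i < M) (- (c * x ^+ n)) ^+ i = 1.
  by split; rewrite // mulrC.
have := subrX1 (- (c * x ^+ n)) M.
rewrite exprNn exprMn -exprM (@expr_nilp _ x M xM (n * M)); last by nia.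
by rewrite !mulr0 sub0r => e; apply: oppr_inj; rewrite e; ring.
Qed.

(** The factors of the triple product have exponents in an arithmetic
progression; this turns them into products over a residue class. *)
Lemma tprod_residue N k K c : (0 < k <= N)%N -> (M <= K)%N ->
  \prod_(i < K) (1 + c * x ^+ (N * i + k)) =
  tprod (fun n => n %% N == k %% N)%N c.
Proof.
move=> /andP[k0 kN] MK; rewrite -(@tprod_widen _ _ (N * K).+1); last by nia.
elim: K {MK} => [|K IHK]; first by rewrite big_ord0 muln0 big_geq.
rewrite big_ord_recr /= IHK [RHS](big_cat_nat (n := (N * K).+1)) //=; last first.
  by rewrite ltnS leq_mul2l leqnSn orbT.
congr (_ * _); transitivity (\prod_((N * K).+1 <= n < (N * K.+1).+1
                                | n == (N * K + k)%N) (1 + c * x ^+ n)).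
  by rewrite big_nat1_eq; case: ifP => // /negbT; nia.
apply: congr_big_nat => // n /andP[nK Kn].
(* [k] may be [N], so that [k %% N] need not be [k] *)
have [m -> m0] : exists2 m, n = (N * K + m)%N & (0 < m <= N)%N.
  by exists (n - N * K)%N; nia.
rewrite eqn_add2l [(N * K)%N]mulnC modnMDl.
case/andP: m0 => m0; rewrite leq_eqVlt => /orP[/eqP-> | mN];
  move: kN; rewrite leq_eqVlt => /orP[/eqP-> | kN]; rewrite ?eqxx // ?modnn;
  rewrite ?modn_small //; lia.
Qed.

Lemma tprod_multiple N K c : (0 < N)%N -> (M <= K)%N ->
  \prod_(i < K) (1 + c * x ^+ (N * i + N)) = tprod (fun n => n %% N == 0)%N c.
Proof. by move=> N0 MK; rewrite tprod_residue ?modnn // N0 leqnn. Qed.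

Lemma tprod_double P :
  \prod_(1 <= n < M | P n.*2) (1 - x ^+ n.*2) =
  tprod (fun n => P n && ~~ odd n) (-1).
Proof.
rewrite -(@tprod_widen _ _ M.*2); last by lia.
rewrite big_mkcond [RHS]big_mkcond /=.
elim: (M) => [|[|m] IHm]; first by rewrite !big_geq.
  by rewrite big_geq // big_nat1 andbF.
rewrite [LHS]big_nat_recr // {}IHm [m.+2.*2]doubleS.
have: (0 < m.+1.*2)%N by [].
move: (m.+1.*2) (odd_double m.+1) => d od d0.
rewrite (big_nat_recr d.+1) // (big_nat_recr d) //.
rewrite [odd d.+1]/= od andbF andbT /= mulr1 mulN1r //.
Qed.

(** Euler's theorem on odd parts and distinct parts, for parts in a set stable
under doubling and halving: multiply by the product of all [1 - x ^+ n],
where [(1 - x ^+ n) * (1 + x ^+ n) = 1 - x ^+ n.*2], and cancel the even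
factors. *)
Lemma euler_odd_distinct (P : pred nat) : (forall n, P n.*2 = P n) ->
  tprod (fun n => P n && odd n) (-1) * tprod P 1 = 1.
Proof.
move=> PD; apply: (mulrI (tprod_unit (fun n => P n && ~~ odd n) (-1))).
rewrite mulr1 mulrA [X in X * _]mulrC -tprodID -tprod_double -big_split /=.
by rewrite [RHS](eq_bigl _ _ PD); apply: eq_bigr => n _; rewrite -addnn exprD; ring.
Qed.

Lemma theta_tprod c L r : c * c = 1 -> (r < L)%N ->
  theta x M c L r = tprod (fun n => n %% L.*2 == 0)%N (-1) *
    (tprod (fun n => n %% L.*2 == L + r)%N c *
     tprod (fun n => n %% L.*2 == L - r)%N c).
Proof.
move=> cc rL; rewrite (triple_product xM (K := M.*2) cc) //; try lia.
rewrite !tprod_residue; try lia.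
rewrite !(@modn_small (_ + r) L.*2) ?(@modn_small (_ - r) L.*2); try lia.
rewrite -(@tprod_multiple _ M) //; last by lia.
by congr (_ * _); apply: eq_bigr => i _; rewrite mulN1r.
Qed.

Lemma theta_tprod_top L : (0 < L)%N ->
  theta x M 1 L L = tprod (fun n => n %% L.*2 == 0)%N (-1) *
    (2 * tprod (fun n => n %% L.*2 == 0)%N 1 ^+ 2).
Proof.
move=> L0; rewrite (triple_product xM (K := M.*2.+1)) ?mulr1 //; try lia.
(* the exponent L - r = 0 gives the factor 1 + 1 *)
have -> : \prod_(i < M.*2.+1) (1 + 1 * x ^+ (L.*2 * i + (L - L))) =
          2 * \prod_(i < M.*2) (1 + 1 * x ^+ (L.*2 * i + L.*2)).
  rewrite subnn big_ord_recl muln0 expr0 mulr1; congr (_ * _).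
  by apply: eq_bigr => i _; rewrite lift0 mulnS addn0 addnC.
rewrite addnn !tprod_multiple; try lia.
under eq_bigr => i _ do rewrite -mulN1r.
by rewrite tprod_multiple; [ring | lia | lia].
Qed.

End TruncatedProducts.

(** * The identity of degree 3 *)

Section Degree3Algebra.
Local Open Scope ring_scope.

(** The four relations between theta quotients say that, up to the two Euler
relations, [1 + 4t], [1 - 2t], [1 + 2t] and [1 + t] are monomials in the
products, [t] being [x] times another. So all terms of the conclusion become rational
functions of [t], and the conclusion becomes the polynomial identity
[((1+t)(1+2t))^3 - ((1+t)(1-2t)(1+4t))^3
   = t^3 ((1+2t)(1+4t))^3 - t^3 (1-2t)^3
     + 24 t^2 (1+t)(1-2t)(1+2t)^2(1+4t)]. *)
Lemma degree3_algebra (R : comUnitRingType) (x A A' B B' C C' Z : R) :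
    (2 : R) \is a GRing.unit -> B \is a GRing.unit ->
    A * A' * B' = 1 -> C * C' * Z = 1 ->
    B ^+ 2 * A' ^+ 2 - B' ^+ 2 * A ^+ 2 = 4 * x * Z ^+ 2 * C * A ->
    B ^+ 2 * C * A - C' * A' * B' ^+ 2 = - (2 * x * A' ^+ 2 * B' * Z) ->
    B ^+ 2 * C' * A' - C * A * B' ^+ 2 = 2 * x * A ^+ 2 * B' * Z ->
    2 * B ^+ 2 * B' * Z - C' * A' * A ^+ 2 = C * A * A' ^+ 2 ->
  B' ^+ 12 - B ^+ 12 = x ^+ 3 * (A' ^+ 12 - A ^+ 12) + 24 * x ^+ 2.
Proof.
move=> u2 uB u1 w1 ra rb rc rd.
pose V := A * A' ^+ 2 * C * Z ^+ 2; pose t := x * V.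
have U4 : B ^+ 2 * A' ^+ 4 = 1 + 4 * t.
  transitivity ((A * A' * B') ^+ 2 +
    A' ^+ 2 * (B ^+ 2 * A' ^+ 2 - B' ^+ 2 * A ^+ 2)); first by ring.
  by rewrite u1 ra /t /V; ring.
have U1 : A' ^+ 2 * B' * C ^+ 2 * Z = 1 + 2 * t.
  transitivity (A' ^+ 2 * B' * C ^+ 2 * Z * (A * A' * B')).
    by rewrite u1 mulr1.
  transitivity (B ^+ 2 * A' ^+ 4 * (C * C' * Z) -
    A' ^+ 3 * C * Z * (B ^+ 2 * C' * A' - C * A * B' ^+ 2)); first by ring.
  rewrite w1 U4 rc; transitivity (1 + 4 * t - 2 * t * (A * A' * B')).
    by rewrite /t /V; ring.
  by rewrite u1; ring.
have U2 : B ^+ 2 * C ^+ 2 * Z * A ^+ 3 * A' = 1 - 2 * t.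
  transitivity ((C * C' * Z) * (A * A' * B') ^+ 2 +
    C * Z * A ^+ 2 * A' * (B ^+ 2 * C * A - C' * A' * B' ^+ 2)); first by ring.
  rewrite rb; transitivity ((C * C' * Z) * (A * A' * B') ^+ 2 -
    2 * t * (A * A' * B')); first by rewrite /t /V; ring.
  by rewrite u1 w1; ring.
have U3 : B ^+ 2 * A' * B' ^+ 3 * C * Z ^+ 2 = 1 + t.
  apply: (mulrI u2); transitivity ((C * C' * Z) * (A * A' * B') ^+ 2 +
    A' * B' ^+ 2 * C * Z * (2 * B ^+ 2 * B' * Z - C' * A' * A ^+ 2)).
    by ring.
  rewrite rd; transitivity ((C * C' * Z) * (A * A' * B') ^+ 2 +
    A' ^+ 2 * B' * C ^+ 2 * Z * (A * A' * B')); first by ring.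
  by rewrite u1 w1 U1; ring.
have [uA uA' uB'] : [/\ A \is a GRing.unit, A' \is a GRing.unit
                     & B' \is a GRing.unit].
  by apply/and3P; rewrite andbA -!unitrM u1 unitr1.
have [uC uZ] : C \is a GRing.unit /\ Z \is a GRing.unit.
  have : C * C' * Z \is a GRing.unit by rewrite w1 unitr1.
  by rewrite !unitrM => /andP[/andP[-> _] ->].
(* two monomials that agree modulo [A * A' * B' = 1] differ by such a power *)
have sub1 k y : y * (A * A' * B') ^+ k = y by rewrite u1 expr1n mulr1.
(* a common denominator of the four rational functions of [t] *)
pose d := V ^+ 2 * (1 - 2 * t) * (1 + 4 * t) * (1 + 2 * t) ^+ 2 * (1 + t).
have ud : d \is a GRing.unit.
  rewrite /d -U1 -U2 -U3 -U4 /V.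
  by rewrite !(unitrM, unitrX_pos) // uA uA' uB uB' uC uZ.
have DB' : B' ^+ 12 * d = ((1 + t) * (1 + 2 * t)) ^+ 3.
  have -> : B' ^+ 12 * d = B' ^+ 12 * V ^+ 2 * (1 - 2 * t) * (1 + 4 * t) *
    ((1 + 2 * t) ^+ 2 * (1 + t)) by rewrite /d; ring.
  have -> : B' ^+ 12 * V ^+ 2 * (1 - 2 * t) * (1 + 4 * t) =
            (1 + t) ^+ 2 * (1 + 2 * t).
    rewrite -U1 -U2 -U3 -U4 -[RHS](sub1 5) /V; ring.
  by ring.
have DB : B ^+ 12 * d = ((1 + t) * (1 - 2 * t) * (1 + 4 * t)) ^+ 3.
  have -> : B ^+ 12 * d = B ^+ 12 * V ^+ 2 * (1 + 2 * t) ^+ 2 *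
    ((1 - 2 * t) * (1 + 4 * t) * (1 + t)) by rewrite /d; ring.
  have -> : B ^+ 12 * V ^+ 2 * (1 + 2 * t) ^+ 2 =
            ((1 + t) * (1 - 2 * t) * (1 + 4 * t)) ^+ 2.
    rewrite -U1 -U2 -U3 -U4 -[LHS](sub1 4) /V; ring.
  by ring.
have DA' : A' ^+ 12 * d = V ^+ 3 * ((1 + 2 * t) * (1 + 4 * t)) ^+ 3.
  have -> : A' ^+ 12 * d = A' ^+ 12 * (1 + t) * (1 - 2 * t) *
    (V ^+ 2 * (1 + 4 * t) * (1 + 2 * t) ^+ 2) by rewrite /d; ring.
  have -> : A' ^+ 12 * (1 + t) * (1 - 2 * t) =
            V * (1 + 2 * t) * (1 + 4 * t) ^+ 2.
    rewrite -U1 -U2 -U3 -U4 -[RHS](sub1 2) /V; ring.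
  by ring.
have DA : A ^+ 12 * d = V ^+ 3 * (1 - 2 * t) ^+ 3.
  have -> : A ^+ 12 * d = A ^+ 12 * (1 + t) * (1 + 2 * t) ^+ 2 * (1 + 4 * t) *
    (V ^+ 2 * (1 - 2 * t)) by rewrite /d; ring.
  have -> : A ^+ 12 * (1 + t) * (1 + 2 * t) ^+ 2 * (1 + 4 * t) =
            V * (1 - 2 * t) ^+ 2.
    rewrite -U1 -U2 -U3 -U4 -[RHS](sub1 5) /V; ring.
  by ring.
apply: (mulIr ud).
transitivity (B' ^+ 12 * d - B ^+ 12 * d); first by ring.
transitivity (x ^+ 3 * (A' ^+ 12 * d - A ^+ 12 * d) + 24 * x ^+ 2 * d).
  by rewrite DB' DB DA' DA /d /t; ring.
by ring.
Qed.

End Degree3Algebra.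

Section Level6.
Local Open Scope ring_scope.
Context {R : comUnitRingType} (x : R) (M : nat).
Hypothesis xM : x ^+ M = 0.
Notation tprod := (tprod x M).
Notation theta := (theta x M).

Lemma level6_product (P : pred nat) c a b : (a != b)%N ->
    (forall n, P n = (n %% 6 == a) || (n %% 6 == b))%N ->
  tprod P c = tprod (fun n => n %% 6 == a)%N c * tprod (fun n => n %% 6 == b)%N c.
Proof.
move=> ab PE; rewrite (tprodID _ _ P (fun n => n %% 6 == a)%N).
congr (_ * _); apply: eq_tprod => n; rewrite PE.
  by case: eqP => //=; rewrite andbF.
by case: eqP => [->|_] /=; rewrite ?andbT ?(negPf ab).
Qed.

(** The generating function form of the result. Up to the common factor [E],
the theta functions of modulus 6 are the products over the odd ([A]) and the
even ([B]) integers prime to 3, over the odd multiples of 3 ([C]) and over the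
multiples of 6 ([Z]). In terms of [b], the four relations required by
[degree3_algebra] are visible polynomial identities; they are instances of
the three-term relation of Weierstrass. *)
Theorem degree3_products : (2 : R) \is a GRing.unit ->
  tprod (fun n => ~~ (3 %| n) && ~~ odd n)%N 1 ^+ 12 -
  tprod (fun n => ~~ (3 %| n) && ~~ odd n)%N (-1) ^+ 12 =
  x ^+ 3 * (tprod (fun n => ~~ (3 %| n) && odd n)%N 1 ^+ 12 -
            tprod (fun n => ~~ (3 %| n) && odd n)%N (-1) ^+ 12) + 24 * x ^+ 2.
Proof.
move=> u2.
have sqN1 : (-1 : R) * -1 = 1 by rewrite mulrNN mulr1.
have sq1 : (1 : R) * 1 = 1 by rewrite mulr1.
pose A c := tprod (fun n => ~~ (3 %| n) && odd n)%N c.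
pose B c := tprod (fun n => ~~ (3 %| n) && ~~ odd n)%N c.
pose C c := tprod (fun n => (3 %| n) && odd n)%N c ^+ 2.
pose Z := tprod (fun n => (3 %| n) && ~~ odd n)%N 1 ^+ 2.
pose E := tprod (fun n => n %% 6 == 0)%N (-1).
pose b i := theta 1 6 i.*2.
have T1 c : c * c = 1 -> theta c 3 1 = E * B c.
  move=> cc; rewrite (theta_tprod xM) // [B c](@level6_product _ _ 4 2) // => n; lia.
have T2 c : c * c = 1 -> theta c 3 2 = E * A c.
  move=> cc; rewrite (theta_tprod xM) // [A c](@level6_product _ _ 5 1) // => n; lia.
have T0 c : c * c = 1 -> theta c 3 0 = E * C c.
  move=> cc; rewrite (theta_tprod xM) // -expr2.
  by congr (_ * _ ^+ 2); apply: eq_tprod => n; lia.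
have T3 : theta 1 3 3 = E * (2 * Z).
  rewrite (theta_tprod_top xM) //.
  by congr (_ * (_ * _ ^+ 2)); apply: eq_tprod => n; lia.
have m10 c : c * c = 1 ->
    E ^+ 2 * B c ^+ 2 = b 1%N * b 0%N + c * x ^+ 2 * (b 2%N * b 3%N).
  by move=> cc; rewrite -exprMn -T1 // expr2 (theta_mul xM (X := 1) (Y := 0)).
have m20 c : c * c = 1 ->
    E ^+ 2 * A c ^+ 2 = b 2%N * b 0%N + c * x * (b 1%N * b 3%N).
  by move=> cc; rewrite -exprMn -T2 // expr2 (theta_mul xM (X := 2) (Y := 0)).
have m30 : E ^+ 2 * (2 * Z) ^+ 2 = 2 * (b 0%N * b 3%N).
  rewrite -exprMn -T3 expr2 (theta_mul xM (X := 3) (Y := 0)) //.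
  rewrite /b /=; ring.
have m11 c : c * c = 1 ->
    E ^+ 2 * (C c * A c) = b 1%N ^+ 2 + c * x * b 2%N ^+ 2.
  move=> cc; rewrite expr2 mulrACA -T2 // -T0 // mulrC.
  by rewrite (theta_mul xM (X := 1) (Y := 1)).
have m21 : E ^+ 2 * (2 * Z * B 1) = 2 * (b 1%N * b 2%N).
  rewrite expr2 mulrACA -T3 -T1 // (theta_mul xM (X := 2) (Y := 1)) //.
  rewrite /b /=; ring.
have uE : E ^+ 4 \is a GRing.unit by rewrite unitrX // tprod_unit.
apply: (@degree3_algebra _ x (A (-1)) (A 1) (B (-1)) (B 1) (C (-1)) (C 1) Z) => //.
- exact: tprod_unit.
- have := euler_odd_distinct xM (P := fun n => ~~ (3 %| n)%N).
  rewrite (tprodID _ _ (fun n => ~~ (3 %| n)%N) odd 1) mulrA; apply=> n; lia.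
- rewrite -!exprMn -[RHS](expr1n _ 2); congr (_ ^+ 2).
  have := euler_odd_distinct xM (P := fun n => 3 %| n)%N.
  rewrite (tprodID _ _ (fun n => 3 %| n)%N odd 1) mulrA; apply=> n; lia.
- apply: (mulrI uE).
  transitivity ((E ^+ 2 * B (-1) ^+ 2) * (E ^+ 2 * A 1 ^+ 2) -
                (E ^+ 2 * B 1 ^+ 2) * (E ^+ 2 * A (-1) ^+ 2)); first by ring.
  transitivity (x * (E ^+ 2 * (2 * Z) ^+ 2) * (E ^+ 2 * (C (-1) * A (-1)))).
    by rewrite !m10 // !m20 // m30 m11 //; ring.
  by ring.
- apply: (mulrI uE).
  transitivity ((E ^+ 2 * B (-1) ^+ 2) * (E ^+ 2 * (C (-1) * A (-1))) -
                (E ^+ 2 * B 1 ^+ 2) * (E ^+ 2 * (C 1 * A 1))); first by ring.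
  transitivity (- (x * (E ^+ 2 * A 1 ^+ 2) * (E ^+ 2 * (2 * Z * B 1)))).
    by rewrite !m10 // !m20 // m21 !m11 //; ring.
  by ring.
- apply: (mulrI uE).
  transitivity ((E ^+ 2 * B (-1) ^+ 2) * (E ^+ 2 * (C 1 * A 1)) -
                (E ^+ 2 * B 1 ^+ 2) * (E ^+ 2 * (C (-1) * A (-1)))); first by ring.
  transitivity (x * (E ^+ 2 * A (-1) ^+ 2) * (E ^+ 2 * (2 * Z * B 1))).
    by rewrite !m10 // !m20 // m21 !m11 //; ring.
  by ring.
- apply: (mulrI uE).
  transitivity ((E ^+ 2 * B (-1) ^+ 2) * (E ^+ 2 * (2 * Z * B 1)) -
    (E ^+ 2 * (C 1 * A 1)) * (E ^+ 2 * A (-1) ^+ 2)); first by ring.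
  transitivity ((E ^+ 2 * (C (-1) * A (-1))) * (E ^+ 2 * A 1 ^+ 2)).
    by rewrite !m10 // !m20 // m21 !m11 //; ring.
  by ring.
Qed.

End Level6.

(** * Coefficients and partitions *)

Section Truncation.
Local Open Scope ring_scope.

Lemma tprod_rmorph (R S : comUnitRingType) (f : {rmorphism R -> S}) x M P c :
  f (tprod x M P c) = tprod (f x) M P (f c).
Proof.
rewrite /tprod rmorph_prod; apply: eq_bigr => n _.
by rewrite rmorphD rmorph1 rmorphM rmorphXn.
Qed.

(** Working modulo ['X^n] makes the variable nilpotent and loses no coefficient
of degree less than [n]. *)
Lemma in_qpoly_coef (A : comNzRingType) (p q : {poly A}) n i : (i < n)%N ->
  in_qpoly 'X^n p = in_qpoly 'X^n q -> p`_i = q`_i.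
Proof.
case: n => // n lt_in /(congr1 (fun r => polyn r)) /=.
rewrite mk_monic_Xn /= => e; have mX := monicXn A n.+1.
rewrite (Pdiv.RingMonic.rdivp_eq mX p) (Pdiv.RingMonic.rdivp_eq mX q).
by rewrite !coefD !coefMXn lt_in e.
Qed.

End Truncation.

Section ColoredSubsets.
Local Open Scope ring_scope.
Variables (M : nat) (P : pred nat).
Implicit Types J : {set 'I_M * 'I_12}.

(** The pair [(n, k)] stands for the copy of the part [n] with color [k]; below
[M] there are finitely many, so partitions are subsets of a finite type. *)
Definition allowed J := [forall i in J, (0 < i.1)%N && P i.1].
Definition weight J : nat := \sum_(i in J) i.1.

Lemma tprod_expansion (c : {poly rat}) : tprod 'X M P c ^+ 12 =
  \sum_(J : {set 'I_M * 'I_12} | allowed J) c ^+ #|J| * 'X^(weight J).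
Proof.
pose F (i : 'I_M * 'I_12) : {poly rat} :=
  if (0 < i.1)%N && P i.1 then c * 'X^(i.1) else 0.
have -> : tprod 'X M P c ^+ 12 = \prod_i (F i + 1).
  rewrite -(pair_bigA _ (fun n k => F (n, k) + 1)) /= /tprod big_geq_mkord.
  rewrite big_mkcond -prodrXl; apply: eq_bigr => n _.
  rewrite (eq_bigr (fun=> F (n, ord0) + 1)) // prodr_const card_ord /F /= andbC.
  case: ifP => _; first by rewrite addrC.
  by rewrite add0r.
rewrite bigA_distr (bigID allowed) /= [X in _ + X]big1 ?addr0.
  apply: eq_bigr => J /forallP aJ; rewrite -big_mkcond /=.
  rewrite -prodr_const /weight -prodrXr -big_split /=; apply: eq_bigr => i iJ.
  by have := aJ i; rewrite iJ /= /F => ->.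
move=> J; rewrite negb_forall => /existsP[i]; rewrite negb_imply => /andP[iJ Ni].
by rewrite (bigD1 i) //= iJ /F (negPf Ni) mul0r.
Qed.

Definition odd_subsets (N : nat) : {set {set 'I_M * 'I_12}} :=
  [set J | [&& allowed J, weight J == N & odd #|J|]].

(** Changing the sign of the terms with an odd number of parts and subtracting
leaves twice these terms. *)
Lemma odd_subsets_coef N :
  (tprod 'X M P 1 ^+ 12 - tprod 'X M P (-1) ^+ 12 : {poly rat})`_N =
  (#|odd_subsets N|.*2)%:R.
Proof.
rewrite !tprod_expansion -sumrB coef_sum -sum1_card -muln2 natrM natr_sum mulr_suml.
rewrite big_mkcond [RHS]big_mkcond; apply: eq_bigr => J _; rewrite inE.
case: (allowed J) => //=; rewrite expr1n -mulrBl -signr_odd.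
rewrite -[weight J == N]eq_sym.
by case: (odd _); rewrite ?andbT ?andbF /= ?expr1 ?expr0 ?subrr ?mul0r ?coef0 //
  ?opprK -?mulr2n ?mulr_natl ?mulrnAl ?mul1r ?coefMn ?coefXn; case: eqP.
Qed.

End ColoredSubsets.

Section Counting.
Local Open Scope ring_scope.
Variables (M : nat) (P : pred nat) (X : set colored).
Hypothesis XP : forall y : colored, X y <-> (0 < y.1)%N && P y.1.

Definition color (i : 'I_M * 'I_12) : colored := (val i.1, i.2).
Definition colored_fset (J : {set 'I_M * 'I_12}) : {fset colored} :=
  [fset color i | i in J]%fset.

Lemma color_inj : injective color.
Proof. by move=> [i c] [j d] [/val_inj -> ->]. Qed.

Lemma colored_fsetP (J : {set 'I_M * 'I_12}) i :
  (color i \in colored_fset J) = (i \in J).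
Proof.
apply/imfsetP/idP => [[j /= jJ /color_inj ->] // | iJ]; by exists i.
Qed.

Lemma odd_partitions_colored N (J : {set 'I_M * 'I_12}) :
  odd_partitions X N (colored_fset J) <-> J \in odd_subsets M P N.
Proof.
have wE : (\sum_(y <- colored_fset J) value y)%N = weight J.
  rewrite big_imfset /=; last by move=> i j _ _; apply: color_inj.
  by rewrite /weight -big_enum.
have cE : #|` colored_fset J| = #|J|.
  by rewrite card_imfset /= -?cardE //; apply: color_inj.
have aE : (forall y, y \in colored_fset J -> X y) <-> allowed P J.
  split=> [XJ | /forallP aJ y /imfsetP[i /= iJ ->]].
    apply/forallP => i; apply/implyP => iJ; apply/(XP (color i)); apply: XJ.
    by rewrite colored_fsetP.
  by apply/XP; have := aJ i; rewrite iJ.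
rewrite inE; split=> [[/aE aJ sJ oJ] | /and3P[/aE aJ /eqP sJ oJ]].
  by rewrite aJ -wE sJ eqxx -cE.
by split; rewrite ?wE ?cE.
Qed.

(** A part is at most the sum of all parts. *)
Lemma odd_partitions_bounded N (Q : {fset colored}) : (N < M)%N ->
  odd_partitions X N Q -> exists J, Q = colored_fset J.
Proof.
move=> NM [_ sQ _]; exists [set i | color i \in Q].
apply/fsetP => -[n c]; apply/idP/imfsetP => [yQ | [i /= ]]; last first.
  by rewrite inE => ? ->.
have nM : (n < M)%N.
  by apply: leq_ltn_trans NM; rewrite -sQ (big_fsetD1 (n, c)) //= leq_addr.
by exists (Ordinal nM, c); rewrite ?inE.
Qed.

Lemma D_card N : (N < M)%N -> Defs.D X N = #|odd_subsets M P N|.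
Proof.
move=> NM; rewrite /Defs.D cardE -(size_map colored_fset); apply: perm_size.
have colored_fset_inj : injective colored_fset.
  by move=> J K JK; apply/setP => i; rewrite -!colored_fsetP JK.
apply: uniq_perm; rewrite ?fset_uniq ?map_inj_uniq ?enum_uniq // => Q.
rewrite in_fset_set; last exact: finite_odd_partitions.
apply/idP/mapP => [/set_mem oQ | [J]].
  have [J QJ] := odd_partitions_bounded NM oQ; exists J => //.
  by rewrite mem_enum; apply/odd_partitions_colored; rewrite -QJ.
by rewrite mem_enum => /odd_partitions_colored oJ ->; apply/mem_set.
Qed.

End Counting.

Section PolynomialForm.
Local Open Scope ring_scope.

(** The coefficients are rational only to make 2 invertible, as
[degree3_products] requires. *)
Lemma degree3_products_image (S : comUnitRingType)
    (f : {rmorphism {poly rat} -> S}) (M : nat)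
    (even_part := (fun n => ~~ (3 %| n) && ~~ odd n)%N)
    (odd_part := (fun n => ~~ (3 %| n) && odd n)%N) :
  f ('X^M) = 0 ->
  f (tprod 'X M even_part 1 ^+ 12 - tprod 'X M even_part (-1) ^+ 12) =
  f ('X^3 * (tprod 'X M odd_part 1 ^+ 12 - tprod 'X M odd_part (-1) ^+ 12)
     + 24 * 'X^2).
Proof.
rewrite rmorphXn => fM.
rewrite [LHS]rmorphB [RHS]rmorphD !rmorphM rmorphB !rmorphXn !tprod_rmorph.
rewrite rmorph_nat !(rmorphN1, rmorph1); apply: degree3_products => //.
by rewrite -(rmorph_nat (f \o polyC) 2) rmorph_unit.
Qed.

End PolynomialForm.

Theorem theorem3p6 (N : nat) (hN : 4 <= N) : D_S N = D_T (N - 3).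
Proof.
pose S n := ~~ (3 %| n) && ~~ odd n; pose T n := ~~ (3 %| n) && odd n.
have SE y : S_set y <-> (0 < y.1) && S y.1.
  by rewrite /S; split=> [[-> -> ->] // | /and3P[? ? ?]]; split.
have TE y : T_set y <-> (0 < y.1) && T y.1.
  by rewrite /T; split=> [[-> -> ->] // | /and3P[? ? ?]]; split.
have XN0 : (in_qpoly 'X^(N.+1) ('X^(N.+1) : {poly rat}) = 0)%R.
  by apply: val_inj; rewrite /= mk_monic_Xn Pdiv.RingMonic.rmodpp ?monicXn.
have e0 :=
  @degree3_products_image {poly %/ 'X^(N.+1)} (in_qpoly 'X^(N.+1)) N.+1 XN0.
have {e0} := in_qpoly_coef (ltnSn N) e0.
rewrite [RHS]coefD coefXnM ltnNge (ltnW hN) /=.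
rewrite !odd_subsets_coef mulr_natl coefMn coefXn.
(* here the term 24 q^2 of the identity disappears *)
have -> : (N == 2) = false by lia.
rewrite mul0rn addr0 => /eqP; rewrite eqr_nat => /eqP/double_inj e.
by rewrite /D_S /D_T (D_card SE (ltnSn N)) (D_card (M := N.+1) TE (leq_subr 3 N)) e.
Qed.
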